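(* Let $A$ be a two-sided skew brace. If $(A,\circ)$ is soluble of derived length $n$, then $(A,+)$ is soluble of derived length at most $n+1$.
   Context: A skew (left) brace is a triple $(A,+,\circ)$ such that $(A,+)$ and $(A,\circ)$ are (not necessarily abelian) groups and $a\circ(b+c)=a\circ b-a+a\circ c$ for all $a,b,c\in A$. It is two-sided if moreover $(a+b)\circ c=a\circ c-c+b\circ c$ for all $a,b,c\in A$. *)

(* Defs.v *)
From HB Require Import structures.
From mathcomp Require Import all_boot.
From mathcomp Require Import classical_sets.

Set Implicit Arguments.
Unset Strict Implicit.
Unset Printing Implicit Defensive.

Declare Scope brace_scope.
Delimit Scope brace_scope with brace.

Local Open Scope classical_set_scope.
Local Open Scope group_scope.

(* The circle operation of a skew brace is the multiplication [*] of a
   (possibly infinite) [groupType]; the addition is a second, not necessarily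
   commutative, group law on the same carrier. *)
HB.mixin Record isSkewBrace A of Group A := {
  sbr_add : A -> A -> A;
  sbr_zero : A;
  sbr_opp : A -> A;
  sbr_addA : associative sbr_add;
  sbr_add0r : left_id sbr_zero sbr_add;
  sbr_addr0 : right_id sbr_zero sbr_add;
  sbr_addNr : left_inverse sbr_zero sbr_opp sbr_add;
  sbr_addrN : right_inverse sbr_zero sbr_opp sbr_add;
  (* a * (b + c) = a * b - a + a * c *)
  sbr_mulDr : forall a b c : A,
    a * sbr_add b c = sbr_add (sbr_add (a * b) (sbr_opp a)) (a * c)
}.

#[short(type="skewBraceType")]
HB.structure Definition SkewBrace := {A of isSkewBrace A & Group A}.

Notation "a + b" := (sbr_add a b) : brace_scope.
Notation "- a" := (sbr_opp a) : brace_scope.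
Notation "a - b" := (sbr_add a (sbr_opp b)) : brace_scope.
Notation "a * b" := (mul a b) : brace_scope.

Definition two_sided (A : skewBraceType) : Prop :=
  forall a b c : A, ((a + b) * c = a * c - c + b * c)%brace.

Definition additive_group (A : skewBraceType) : Type := A.

HB.instance Definition _ (A : skewBraceType) :=
  Choice.on (additive_group A).
HB.instance Definition _ (A : skewBraceType) :=
  isGroup.Build (additive_group A)
    (@sbr_addA A) (@sbr_add0r A) (@sbr_addr0 A) (@sbr_addNr A) (@sbr_addrN A).

Definition circle_group (A : skewBraceType) : Type := A.

HB.instance Definition _ (A : skewBraceType) := Group.on (circle_group A).

Section DerivedSeries.
Variable G : groupType.

Definition subgroup (H : set G) : Prop :=
  H 1 /\ forall x y : G, H x -> H y -> H (x / y).

Definition derived_subgroup (H : set G) : set G :=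
  smallest subgroup [set [~ x, y] | x in H & y in H].

Definition derived_series (n : nat) : set G := iter n derived_subgroup setT.

Definition soluble_of_derived_length (n : nat) : Prop :=
  derived_series n = [set 1] /\
  forall m : nat, (m < n)%N -> derived_series m <> [set 1].

End DerivedSeries.

Arguments derived_series G n : clear implicits.

(* Main.v *)
Require Import Defs.
From mathcomp Require Import all_boot.
From mathcomp Require Import boolp classical_sets.

(** Write [star a b = - a + a o b - b] and [star_op a b = - b + a o b - a].
    Expanding [(a + b) o (c + d)] with the two distributivity laws in either
    order shows that [star a d] and [star_op b c] commute additively. The
    elements [star a b] generate an additive normal subgroup [I] modulo which
    [a o b] is [a + b]; the elements [star_op a b] generate one, [J], modulo
    which [a o b] is [b + a]. Hence the [n]-th term of the additive derived
    series lies in both [I] and [J], which centralise each other, so it is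
    abelian. *)

Set Implicit Arguments.
Unset Strict Implicit.
Unset Printing Implicit Defensive.

Local Open Scope classical_set_scope.
Local Open Scope group_scope.

(** * Generated subgroups and the derived series *)

Section Subgroups.
Variable G : groupType.
Implicit Types (N S : set G) (x y z : G).

Lemma subgroupV N x : subgroup N -> N x -> N x^-1.
Proof. by move=> [N1 ND] Nx; rewrite -(mul1g x^-1); exact: ND. Qed.

Lemma subgroupM N x y : subgroup N -> N x -> N y -> N (x * y).
Proof.
move=> sN Nx Ny; rewrite -(invgK y); apply: sN.2 => //; exact: subgroupV.
Qed.

Lemma smallest_subgroup S : subgroup (smallest (@subgroup G) S).
Proof.
split=> [N [[]]//|x y Sx Sy N [sN SN]].
by apply: sN.2; [apply: Sx | apply: Sy].
Qed.

Lemma centraliser_subgroup S : subgroup [set x | forall y, S y -> commute x y].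
Proof.
split=> [y _|x y cx cy z Sz /=]; first exact/commute_sym/commute1.
by apply/commute_sym/commuteM; [|apply: commuteV]; apply/commute_sym; auto.
Qed.

(** Centralisers are subgroups, so commutation passes from generators to generated subgroups, first
    on the [S] side, then on the [S'] side. *)
Lemma smallest_subgroup_commute S S' :
  (forall x y, S x -> S' y -> commute x y) ->
  forall x y, smallest (@subgroup G) S x -> smallest (@subgroup G) S' y ->
  commute x y.
Proof.
move=> cSS' x y Sx S'y.
have cS' z : S' z -> commute x z.
  move=> S'z; apply: (Sx [set t | forall u, S' u -> commute t u]) => //.
  by split; [exact: centraliser_subgroup | move=> t St u; exact: cSS'].
apply/commute_sym; apply: (S'y [set t | forall u, u = x -> commute t u]) => //.
split; first exact: (centraliser_subgroup [set x]).
by move=> t S't _ ->; apply/commute_sym/cS'.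
Qed.

(** For fixed [y], the elements whose conjugate by [y] stays inside form a subgroup, so generators
    suffice. *)
Lemma smallest_subgroup_normal S :
  (forall x y, S x -> smallest (@subgroup G) S (x ^ y)) ->
  forall x y, smallest (@subgroup G) S x -> smallest (@subgroup G) S (x ^ y).
Proof.
move=> nS x y Sx; have [S1 SD] := smallest_subgroup S.
apply: (Sx [set t | smallest (@subgroup G) S (t ^ y)]); split.
  split=> [|t u /= St Su]; first by rewrite /= conj1g.
  by rewrite conjMg conjVg; exact: SD.
by move=> t St; exact: nS.
Qed.

Lemma derived_series_subgroup k : subgroup (derived_series G k).
Proof. by case: k => [|k]; [split | exact: smallest_subgroup]. Qed.

Lemma derived_series_abelian k :
  (forall x y, derived_series G k x -> derived_series G k y -> commute x y) ->
  derived_series G k.+1 = [set 1].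
Proof.
move=> cD; apply/seteqP; split=> [x Dx|x ->]; last first.
  exact: (derived_series_subgroup k.+1).1.
apply: (Dx [set 1]); split.
  by split=> // y z -> ->; rewrite invg1 mulg1.
by move=> _ [y Dy] [z Dz] <-; apply/eqP/commgP/cD.
Qed.

Lemma derived_series_soluble k : derived_series G k = [set 1] ->
  exists2 m, m <= k & soluble_of_derived_length G m.
Proof.
(* [asbool] makes the condition boolean, so that a least index can be extracted. *)
move=> Dk; have exD : exists m, `[< derived_series G m = [set 1] >].
  by exists k; apply/asboolP.
have [m /asboolP Dm minm] := ex_minnP exD.
exists m; first by apply/minm/asboolP.
split=> // i ltim Di; have := minm i (introT (asboolP _) Di).
by rewrite leqNgt ltim.
Qed.

End Subgroups.

(** * Derived series under a homomorphism modulo a normal subgroup *)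

Section NormalCongruence.
Variables (H G : groupType) (N : set G) (f : H -> G).
Hypotheses (sN : subgroup N) (nN : forall x y, N x -> N (x ^ y)).

Let cong x y := N (x / y).

Let cong_sym x y : cong x y -> cong y x.
Proof. by move=> /(subgroupV sN); rewrite invgM invgK. Qed.

Let cong_trans y x z : cong x y -> cong y z -> cong x z.
Proof.
by move=> Nxy Nyz; have := subgroupM sN Nxy Nyz; rewrite mulgA mulgVK.
Qed.

Let congM x x' y y' : cong x y -> cong x' y' -> cong (x * x') (y * y').
Proof.
(* [(x * x') / (y * y')] is [(x' / y') ^ x^-1] times [x / y]. *)
move=> Nxy Nxy'; have := subgroupM sN (nN x^-1 Nxy') Nxy.
by rewrite conjgE invgK !mulgA mulgVK /cong invgM !mulgA.
Qed.

Let congV x y : cong x y -> cong x^-1 y^-1.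
Proof.
move=> /(subgroupV sN) /(nN x).
by rewrite conjgE invgM invgK mulgVK /cong invgK.
Qed.

(* [f] is a surjective homomorphism modulo [N], without forming the quotient. *)
Hypotheses (fM : forall x y, cong (f (x * y)) (f x * f y)).
Hypothesis f_surj : forall g, exists h, f h = g.

Let f1 : cong (f 1) 1.
Proof. by have := cong_sym (fM 1 1); rewrite /cong mulg1 mulgK invg1 mulg1. Qed.

Let fV x : cong (f x^-1) (f x)^-1.
Proof.
have := cong_trans (cong_sym (fM x^-1 x)); rewrite mulVg => /(_ _ f1).
by rewrite /cong invg1 mulg1 invgK.
Qed.

Let fR x y : cong (f [~ x, y]) [~ f x, f y].
Proof.
rewrite /commg !conjgE.
apply: (cong_trans (fM _ _)); apply: congM; first exact: fV.
apply: (cong_trans (fM _ _)); apply: congM; first exact: fV.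
exact: fM.
Qed.

(** Induction on [k]: surjectivity of [f] starts it; then the elements with such an [h] form a
    subgroup, which contains the commutators because [f] respects them modulo [N]. *)
Lemma derived_series_congruence k g : derived_series G k g ->
  exists2 h, derived_series H k h & N (f h / g).
Proof.
elim: k g => [|k IHk] g.
  by move=> _; have [h <-] := f_surj g; exists h => //; rewrite mulgV; case: sN.
move=> Dg.
apply: (Dg [set g | exists2 h, derived_series H k.+1 h & cong (f h) g]).
have sD := derived_series_subgroup H k.+1.
split; first split.
- by exists 1; [exact: sD.1 | exact: f1].
- move=> x y [h Dh fh] [h' Dh' fh']; exists (h / h'); first exact: sD.2.
  apply: (cong_trans (fM _ _)); apply: congM => //.
  by apply: (cong_trans (fV _)); exact: congV.
move=> _ [x /IHk[h Dh fh]] [y /IHk[h' Dh' fh']] <-.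
exists [~ h, h']; first by move=> K [_]; apply; exists h => //; exists h'.
apply: (cong_trans (fR _ _)); rewrite /commg !conjgE.
by apply: congM; [exact: congV|apply: congM; [exact: congV|exact: congM]].
Qed.

(** The lift of [g] can only be [1], so [g] is congruent to [f 1], which lies in [N]. *)
Lemma derived_series_sub_normal k : derived_series H k = [set 1] ->
  derived_series G k `<=` N.
Proof.
move=> Hk g /derived_series_congruence[h]; rewrite Hk => -> Ng.
by have := cong_trans (cong_sym Ng) f1; rewrite /cong invg1 mulg1.
Qed.

End NormalCongruence.

(** * The two commuting normal subgroups of the additive group *)

Section TwoSided.
Variable A : skewBraceType.
Local Notation G := (additive_group A).
Implicit Types a b c d : G.

(* From here on [*], [^-1] and [/] on [G] are the addition of the brace. *)
Definition circ a b : G := (a : circle_group A) * (b : circle_group A).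

Lemma circDr a b c : circ a (b * c) = circ a b / a * circ a c.
Proof. exact: sbr_mulDr. Qed.

Definition star a b : G := a^-1 * circ a b / b.
Definition star_op a b : G := b^-1 * circ a b / a.

Definition stars := smallest (@subgroup G) [set star p.1 p.2 | p in setT].
Definition stars_op := smallest (@subgroup G) [set star_op p.1 p.2 | p in setT].

Lemma stars_gen a b : stars (star a b).
Proof. by move=> N [_]; apply; exists (a, b). Qed.

Lemma stars_op_gen a b : stars_op (star_op a b).
Proof. by move=> N [_]; apply; exists (a, b). Qed.

(** Expanding [circ a (c^-1 * b)] by [circDr] writes a conjugate of a generator through generators,
    whence [stars] is normal. *)
Lemma starJ a b c : star a b ^ c = (star a c^-1)^-1 * star a (c^-1 * b).
Proof.
by rewrite /star circDr conjgE !(invgM, invgK, mulgA) !(mulgVK, mulgK).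
Qed.

Lemma star_opJ a b c : star_op a b ^ c = star_op a (b * c) / star_op a c.
Proof.
by rewrite /star_op circDr conjgE !(invgM, invgK, mulgA) !(mulgVK, mulgK).
Qed.

Lemma stars_normal a b : stars a -> stars (a ^ b).
Proof.
apply: smallest_subgroup_normal => _ {}b [[a' b'] _ <-] /=.
have sS := smallest_subgroup [set star p.1 p.2 | p in setT].
rewrite starJ; apply: (subgroupM sS); last exact: stars_gen.
by apply: (subgroupV sS); exact: stars_gen.
Qed.

Lemma stars_op_normal a b : stars_op a -> stars_op (a ^ b).
Proof.
apply: smallest_subgroup_normal => _ {}b [[a' b'] _ <-] /=.
have sS := smallest_subgroup [set star_op p.1 p.2 | p in setT].
by rewrite star_opJ; apply: sS.2; exact: stars_op_gen.
Qed.

Hypothesis A2 : two_sided A.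

Lemma circDl a b c : circ (a * b) c = circ a c / c * circ b c.
Proof. exact: A2. Qed.

Lemma star_commute a b c d : commute (star a d) (star_op b c).
Proof.
(* Both expansions of [circ (a * b) (c * d)] start with [circ a c] and end with [circ b d];
   cancelling these leaves the two products to compare. *)
have := circDl a b (c * d); rewrite !circDr !circDl !invgM !mulgA => /mulIg E.
rewrite -!mulgA in E; move/mulgI: E.
by rewrite /commute /star /star_op !mulgA => ->.
Qed.

Lemma stars_commute a b : stars a -> stars_op b -> commute a b.
Proof.
apply: smallest_subgroup_commute => _ _ [[? ?] _ <-] [[? ?] _ <-].
exact: star_commute.
Qed.

Lemma derived_series_stars n :
  derived_series (circle_group A) n = [set 1] -> derived_series G n `<=` stars.
Proof.
apply: (@derived_series_sub_normal (circle_group A) G stars id).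
- exact: smallest_subgroup.
- exact: stars_normal.
(* Conjugating [star a b] by [a^-1] gives [circ a b / (a * b)]. *)
- move=> a b; have := stars_normal (a : G)^-1 (stars_gen a b).
  by rewrite conjgE invgK /star invgM !mulgA mulgV mul1g.
- by move=> a; exists a.
Qed.

(** Modulo [stars_op] the identity reverses products, so additive inversion serves as the
    homomorphism instead. *)
Lemma derived_series_stars_op n :
  derived_series (circle_group A) n = [set 1] ->
  derived_series G n `<=` stars_op.
Proof.
apply: (@derived_series_sub_normal (circle_group A) G stars_op
          (fun a => (a : G)^-1)).
- exact: smallest_subgroup.
- exact: stars_op_normal.
- move=> a b; have := stars_op_normal (a : G) (stars_op_gen a b).
  move=> /(subgroupV (smallest_subgroup _)).
  by rewrite -conjVg conjgE /star_op !(invgM, invgK, mulgA) mulVg mul1g.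
- by move=> a; exists (a : G)^-1; rewrite invgK.
Qed.

End TwoSided.

Theorem theorem4p11 (A : skewBraceType) (n : nat) :
  two_sided A ->
  soluble_of_derived_length (circle_group A) n ->
  exists2 m : nat, m <= n.+1 & soluble_of_derived_length (additive_group A) m.
Proof.
move=> A2 [Dn _]; apply/derived_series_soluble/derived_series_abelian => x y.
(* Each of [x] and [y] lies in both subgroups; one membership of each is enough for them to
   commute. *)
move=> /(derived_series_stars Dn) Ix /(derived_series_stars_op Dn) Jy.
exact: (stars_commute A2).
Qed.
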